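(* Let $A\boldsymbol{x}=\boldsymbol{b}$ be a consistent linear system of equations, where $A\in\mathbb{R}^{M\times N}$ has full column rank, with rows $\boldsymbol{a}_1,\dots,\boldsymbol{a}_M$ and $\boldsymbol{b}=(b_1,\dots,b_M)$, and let $\boldsymbol{x}_{0}$ be an arbitrary initial approximation to the solution of $A\boldsymbol{x}=\boldsymbol{b}$. For $p=0,1,2,\dots$ compute $$\boldsymbol{x}_{p+1}=\boldsymbol{x}_{p}+\frac{b_{r}-\langle\boldsymbol{a}_{r},\boldsymbol{x}_{p}\rangle}{\|\boldsymbol{a}_{r}\|_{2}^{2}}\,\boldsymbol{a}_{r},$$ where at each step the index $r$ is chosen from the set $\{1,2,\dots,M\}$ at random, with any probability distribution. Let $\boldsymbol{x}^{*}$ be the solution of $A\boldsymbol{x}=\boldsymbol{b}$. Then $$\mathbb{E}\,\|\boldsymbol{x}_{p}-\boldsymbol{x}^{*}\|_{2}^{2}\le\big(1-\kappa(B)^{-2}\big)^{p}\,\|\boldsymbol{x}_{0}-\boldsymbol{x}^{*}\|_{2}^{2},$$ where $\kappa(B)=\|B\|_{F}\,\|B^{\dagger}\|_{2}$ is the scaled condition number of a matrix $B$ that is obtained by some row-scaling of $A$.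
   Context: A row-scaling of $A$ is a matrix obtained from $A$ by multiplying each of its rows by a scalar. $\|\cdot\|_F$ is the Frobenius norm, $B^{\dagger}$ is the (left) pseudo-inverse of $B$, and $\|B^\dagger\|_2$ is its spectral norm. For vectors, $\|\cdot\|_2$ is the Euclidean norm and $\langle\cdot,\cdot\rangle$ the Euclidean inner product; the rows $\boldsymbol{a}_i$ are regarded as vectors in $\mathbb{R}^N$.
   Formalization: Rows chosen with positive probability are assumed nonzero; draws are independent with one fixed distribution; κ(B) is taken as +∞ (rate 1) when B lacks full column rank, which is needed when the rows of positive probability do not span R^N (e.g. A = I_2 with probabilities 1, 0). *)

(* Defs.v *)
From HB Require Import structures.
From mathcomp Require Import all_boot all_order all_algebra.
From mathcomp Require Import all_classical all_reals all_analysis.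

Set Implicit Arguments.
Unset Strict Implicit.
Unset Printing Implicit Defensive.

Import Order.TTheory GRing.Theory Num.Theory.

Local Open Scope classical_set_scope.
Local Open Scope ring_scope.

Definition dotv (R : realType) (n : nat) (u v : 'cV[R]_n) : R :=
  \sum_(i < n) u i 0 * v i 0.

Definition norm2 (R : realType) (n : nat) (u : 'cV[R]_n) : R :=
  Num.sqrt (dotv u u).

Definition frob_norm (R : realType) (m n : nat) (B : 'M[R]_(m, n)) : R :=
  Num.sqrt (\sum_(i < m) \sum_(j < n) B i j ^+ 2).

Definition spectral_norm (R : realType) (m n : nat) (B : 'M[R]_(m, n)) : R :=
  sup [set norm2 (B *m v) | v in [set v : 'cV[R]_n | norm2 v <= 1]].

Definition full_col_rank (R : realType) (m n : nat) (B : 'M[R]_(m, n)) : bool :=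
  \rank B == n.

(* Meaningful when B has full column rank: then B^T B is invertible and
   lpinv B *m B = 1. *)
Definition lpinv (R : realType) (m n : nat) (B : 'M[R]_(m, n)) : 'M[R]_(n, m) :=
  invmx (B^T *m B) *m B^T.

(* If B is not of full column rank it has no left inverse; its norm is then
   +oo, i.e. the infimum of the C such that |v| <= C |B v| for all v. *)
Definition lpinv_norm (R : realType) (m n : nat) (B : 'M[R]_(m, n)) : \bar R :=
  if full_col_rank B then (spectral_norm (lpinv B))%:E else +oo%E.

(* Since +oo^-1 = 0, kappa B ^-2 is 0 for B != 0 without full column rank.
   For B = 0 the product 0 * +oo is 0, a junk value. *)
Definition kappa (R : realType) (m n : nat) (B : 'M[R]_(m, n)) : \bar R :=
  ((frob_norm B)%:E * lpinv_norm B)%E.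

Definition row_scaling (R : realType) (m n : nat) (A B : 'M[R]_(m, n)) : Prop :=
  exists d : 'I_m -> R, forall i, row i B = d i *: row i A.

Definition rowv (R : realType) (m n : nat) (A : 'M[R]_(m, n)) (i : 'I_m) :
  'cV[R]_n := (row i A)^T.

Definition kaczmarz_step (R : realType) (m n : nat) (A : 'M[R]_(m, n))
    (b : 'cV[R]_m) (i : 'I_m) (x : 'cV[R]_n) : 'cV[R]_n :=
  x + ((b i 0 - dotv (rowv A i) x) / norm2 (rowv A i) ^+ 2) *: rowv A i.

Fixpoint kaczmarz (R : realType) (m n : nat) (A : 'M[R]_(m, n))
    (b : 'cV[R]_m) (x0 : 'cV[R]_n) (r : nat -> 'I_m) (p : nat) : 'cV[R]_n :=
  if p is q.+1 then kaczmarz_step A b (r q) (kaczmarz A b x0 r q) else x0.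

Definition is_distribution (R : realType) (m : nat) (mu : 'I_m -> R) : Prop :=
  (forall i, 0 <= mu i) /\ \sum_(i < m) mu i = 1.

(* 'I_m carries the discrete sigma-algebra. *)
Definition iid_draws (R : realType) (d : measure_display)
    (T : measurableType d) (Pr : probability T R) (m : nat) (mu : 'I_m -> R)
    (r : nat -> T -> 'I_m) : Prop :=
  [/\ forall (k : nat) (S : set 'I_m), measurable (r k @^-1` S),
      forall (k : nat) (i : 'I_m), Pr (r k @^-1` [set i]) = (mu i)%:E
    & forall (J : seq nat) (S : nat -> set 'I_m), uniq J ->
        Pr (\bigcap_(k in [set` J]) (r k @^-1` S k)) =
        (\prod_(k <- J) Pr (r k @^-1` S k))%E].

(* Main.v *)
(* Take B with rows sqrt(mu_i) a_i / |a_i|, so that |B|_F = 1. Writing e for the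
   current error, a step with row i is the orthogonal projection of e away from
   a_i and lowers |e|^2 by <a_i, e>^2 / |a_i|^2; the mu-average of this decrease
   is |B e|^2, which is at least |e|^2 / |B^+|_2^2 when B has full column rank.
   Otherwise kappa(B) is infinite and it is enough that the mean error does not
   grow. The one-step bound is iterated using the independence of the draws. *)
Require Import Defs.
From HB Require Import structures.
From mathcomp Require Import all_boot all_order all_algebra.
From mathcomp Require Import all_classical all_reals all_analysis.
From mathcomp Require Import measurable_realfun ring.

Set Implicit Arguments.
Unset Strict Implicit.
Unset Printing Implicit Defensive.

Import Order.TTheory GRing.Theory Num.Theory.

Local Open Scope ring_scope.

(** * Euclidean norm, spectral norm and left pseudo-inverse *)

Section Euclidean.
Context {R : realType}.

Lemma dotv_ge0 n (u : 'cV[R]_n) : 0 <= dotv u u.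
Proof. by apply: sumr_ge0 => i _; rewrite -expr2 sqr_ge0. Qed.

Lemma sqr_norm2 n (u : 'cV[R]_n) : norm2 u ^+ 2 = dotv u u.
Proof. by rewrite sqr_sqrtr ?dotv_ge0. Qed.

Lemma norm2_ge0 n (u : 'cV[R]_n) : 0 <= norm2 u.
Proof. exact: sqrtr_ge0. Qed.

Lemma sqr_coord_le n (u : 'cV[R]_n) i : u i 0 ^+ 2 <= norm2 u ^+ 2.
Proof.
rewrite sqr_norm2 /dotv (bigD1 i) //= -expr2 lerDl.
by apply: sumr_ge0 => j _; rewrite -expr2 sqr_ge0.
Qed.

Lemma norm2_eq0 n (u : 'cV[R]_n) : (norm2 u == 0) = (u == 0).
Proof.
apply/eqP/eqP => [u0|->].
  apply/matrixP => i j; rewrite ord1 mxE; apply/eqP.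
  rewrite -sqrf_eq0 eq_le sqr_ge0 andbT.
  by have := sqr_coord_le u i; rewrite u0 expr0n.
by rewrite /norm2 /dotv big1 ?sqrtr0 // => i _; rewrite mxE mulr0.
Qed.

Lemma norm2Z n (c : R) (u : 'cV[R]_n) : norm2 (c *: u) = `|c| * norm2 u.
Proof.
rewrite -sqrtr_sqr -sqrtrM ?sqr_ge0 // /norm2; congr Num.sqrt.
by rewrite /dotv mulr_sumr; apply: eq_bigr => i _; rewrite !mxE; ring.
Qed.

Lemma dotvBr n (u v w : 'cV[R]_n) : dotv u (v - w) = dotv u v - dotv u w.
Proof.
by rewrite /dotv -sumrB; apply: eq_bigr => i _; rewrite !mxE mulrBr.
Qed.

Lemma dotv_subZ n (t : R) (u v : 'cV[R]_n) :
  dotv (u - t *: v) (u - t *: v) =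
  dotv u u - 2 * t * dotv v u + t ^+ 2 * dotv v v.
Proof.
rewrite /dotv !mulr_sumr -sumrB -big_split /=.
by apply: eq_bigr => i _; rewrite !mxE; ring.
Qed.

Lemma mulmx_dotv m n (A : 'M[R]_(m, n)) (x : 'cV[R]_n) i :
  (A *m x) i 0 = dotv (rowv A i) x.
Proof. by rewrite mxE /dotv; apply: eq_bigr => j _; rewrite !mxE. Qed.

(** The coordinates of a vector of the unit ball are at most 1 in absolute value, so each coordinate
    of [C *m v] is bounded by the l1 norm of a row of [C]. Hence the [sup] in [spectral_norm] is an
    actual least upper bound. *)
Lemma has_ubound_spectral m n (C : 'M[R]_(m, n)) :
  has_ubound
    [set norm2 (C *m v) | v in [set v : 'cV[R]_n | norm2 v <= 1]]%classic.
Proof.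
exists (Num.sqrt (\sum_i (\sum_j `|C i j|) ^+ 2)) => _ [v /= v1 <-].
rewrite ler_wsqrtr //; apply: ler_sum => i _.
rewrite -expr2 -real_normK ?num_real // ler_sqr ?nnegrE ?normr_ge0 //; last first.
  exact: sumr_ge0.
rewrite mxE (le_trans (ler_norm_sum _ _ _)) //; apply: ler_sum => j _.
rewrite normrM ler_piMr // -(@ler_pXn2r _ 2) ?nnegrE //.
rewrite real_normK ?num_real // expr1n (le_trans (sqr_coord_le v j)) //.
by rewrite expr_le1 // norm2_ge0.
Qed.

Lemma norm2_mulmx_le m n (C : 'M[R]_(m, n)) (v : 'cV[R]_n) :
  norm2 (C *m v) <= spectral_norm C * norm2 v.
Proof.
have [->|v0] := eqVneq v 0.
  have z k : norm2 (0 : 'cV[R]_k) = 0 by apply/eqP; rewrite norm2_eq0.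
  by rewrite mulmx0 !z mulr0.
have nv : 0 < norm2 v by rewrite lt_def norm2_ge0 norm2_eq0 v0.
rewrite -ler_pdivrMr //.
have /ubP ub := ub_le_sup (has_ubound_spectral C).
apply: ub; exists ((norm2 v)^-1 *: v) => /=.
  by rewrite norm2Z ger0_norm ?invr_ge0 ?norm2_ge0 // mulVf // gt_eqF.
by rewrite -scalemxAr norm2Z ger0_norm ?invr_ge0 ?norm2_ge0 // mulrC.
Qed.

(** The Gram matrix [B^T *m B] is invertible: a row [v] that it kills satisfies |B v^T|^2 = v B^T B
    v^T = 0, and full column rank then forces v = 0. *)
Lemma lpinvK m n (B : 'M[R]_(m, n)) : full_col_rank B -> lpinv B *m B = 1%:M.
Proof.
move=> rB; rewrite /lpinv -mulmxA mulVmx // -row_free_unit.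
have fB : row_free B^T by rewrite /row_free mxrank_tr.
apply: inj_row_free => v /(congr1 (mulmx^~ v^T)); rewrite mul0mx.
set u := (v *m B^T)^T => h.
have : norm2 u == 0.
  rewrite -sqrf_eq0 sqr_norm2; apply/eqP.
  have -> : dotv u u = (u^T *m u) 0 0.
    by rewrite mxE; apply: eq_bigr => i _; rewrite !mxE.
  have -> : u^T *m u = 0.
    by rewrite -h /u trmxK trmx_mul trmxK !mulmxA.
  by rewrite mxE.
rewrite norm2_eq0 /u trmx_eq0 mulmx_free_eq0 //.
by move/eqP.
Qed.

(** Writing v as B^+ (B v) turns the norm of the pseudo-inverse into a lower bound for |B v|, the
    form in which it enters the convergence rate. *)
Lemma norm2_le_lpinv m n (B : 'M[R]_(m, n)) (v : 'cV[R]_n) :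
  full_col_rank B -> norm2 v <= spectral_norm (lpinv B) * norm2 (B *m v).
Proof.
by move=> /lpinvK BK; rewrite -{1}[v]mul1mx -BK -mulmxA norm2_mulmx_le.
Qed.

End Euclidean.

(** * Averages along a randomly driven iteration *)

Section RandomIteration.
Context {R : realType} (X : Type) (M : nat) (mu : 'I_M -> R).
Context (step : 'I_M -> X -> X) (x0 : X).

(** This is the p-th power of the Markov operator of the iteration, applied to the test function [h]
    and evaluated at [x0]. The last step is averaged first, so no probability space is involved. *)
Fixpoint mean_iter (p : nat) (h : X -> R) : R :=
  if p is q.+1 then mean_iter q (fun z => \sum_i mu i * h (step i z))
  else h x0.

Lemma mean_iter_sum (I : finType) (c : I -> R) (h : I -> X -> R) p :
  mean_iter p (fun z => \sum_j c j * h j z) = \sum_j c j * mean_iter p (h j).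
Proof.
elim: p h => [//|p IH] h /=; rewrite -IH; congr mean_iter; apply/funext => z.
under eq_bigr do rewrite mulr_sumr.
rewrite exchange_big /=; apply: eq_bigr => j _.
by rewrite mulr_sumr; apply: eq_bigr => i _; rewrite mulrCA.
Qed.

Lemma mean_iterZ (c : R) (h : X -> R) p :
  mean_iter p (fun z => c * h z) = c * mean_iter p h.
Proof.
have := @mean_iter_sum 'I_1 (fun=> c) (fun=> h) p.
rewrite big_ord1 => <-; congr mean_iter.
by apply/funext => z; rewrite big_ord1.
Qed.

Hypothesis mu_ge0 : forall i, 0 <= mu i.

Lemma mean_iter_le p (h g : X -> R) :
  (forall z, h z <= g z) -> mean_iter p h <= mean_iter p g.
Proof.
elim: p h g => [|p IH] h g hg /=; first exact: hg.
by apply: IH => z; apply: ler_sum => i _; exact: ler_wpM2l.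
Qed.

(** The one-step bound holds at every point, so monotonicity of [mean_iter] applies it to the last
    step and linearity extracts the factor [q]. *)
Lemma mean_iter_contract (q : R) (V : X -> R) p :
  0 <= q -> (forall z, \sum_i mu i * V (step i z) <= q * V z) ->
  mean_iter p V <= q ^+ p * V x0.
Proof.
move=> q0 qV; elim: p => [|p IH]; first by rewrite expr0 mul1r.
rewrite exprS -mulrA (le_trans (mean_iter_le p qV)) //.
by rewrite mean_iterZ ler_wpM2l.
Qed.

(** * Identification of these averages with expectations over independent draws *)

Section Draws.
Local Open Scope classical_set_scope.
Context (d : measure_display) (T : measurableType d) (Pr : probability T R).
Context (r : nat -> T -> 'I_M) (hr : iid_draws Pr mu r).

Definition cylinder (J : seq nat) (i : nat -> 'I_M) : set T :=
  \bigcap_(k in [set` J]) (r k @^-1` [set i k]).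

Lemma measurable_cylinder J i : measurable (cylinder J i).
Proof.
case: hr => mr _ _; apply: fin_bigcap_measurable => // k _; exact: mr.
Qed.

Lemma probability_cylinder J i : uniq J ->
  Pr (cylinder J i) = (\prod_(k <- J) mu (i k))%:E.
Proof.
case: hr => _ pr ind uJ; rewrite /cylinder (ind J (fun k => [set i k])) //.
by rewrite -prodEFin; apply: eq_bigr => k _; exact: pr.
Qed.

Context (x : nat -> T -> X).
Hypothesis x_0 : forall w, x 0 w = x0.
Hypothesis x_S : forall p w, x p.+1 w = step (r p w) (x p w).

(** [X] carries no sigma-algebra and [h] is arbitrary. Splitting by the value of the last draw gives
    a finite sum of indicators times functions of the previous iterate. *)
Lemma measurable_iterate p (h : X -> R) :
  measurable_fun setT (fun w => h (x p w)).
Proof.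
case: hr => mr _ _.
elim: p h => [|p IH] h.
  under eq_fun do rewrite x_0.
  exact: measurable_cst.
have -> : (fun w => h (x p.+1 w)) =
    (fun w => \sum_j \1_(r p @^-1` [set j]) w * h (step j (x p w))).
  apply/funext => w; rewrite x_S (bigD1 (r p w)) //= big1 => [|j jr].
    by rewrite addr0 indicE mem_set // mul1r.
  rewrite indicE memNset ?mul0r //= => jE.
  by move: jr; rewrite jE eqxx.
apply: measurable_sum => j; apply: measurable_funM.
  exact/measurable_indicP/mr.
exact: IH (h \o step j).
Qed.

(* The cylinder records draws later than time p, which are independent of the
   p-th iterate. *)
Lemma integral_cylinder p (h : X -> R) J i :
  (forall z, 0 <= h z) -> uniq J -> all (leq p) J ->
  (\int[Pr]_(w in cylinder J i) (h (x p w))%:E =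
   (mean_iter p h * \prod_(k <- J) mu (i k))%:E)%E.
Proof.
elim: p h J i => [|p IH] h J i h0 uJ pJ.
  under eq_integral do rewrite x_0.
  rewrite (integral_cst Pr (measurable_cylinder J i)) /=.
  by rewrite probability_cylinder // EFinM.
(* The events [F j] partition the cylinder by the value of draw [p], which [J] does not yet
   constrain. *)
pose F j := cylinder (p :: J) (fun k => if k == p then j else i k).
have pnJ : p \notin J.
  by apply/negP => /(allP pJ); rewrite ltnn.
have FE j w : F j w <-> r p w = j /\ cylinder J i w.
  split=> [Fw|[rj cw] k /=].
    split=> [|k kJ].
      by have := Fw p; rewrite /= eqxx; apply; exact: mem_head.
    have := Fw k; rewrite /= ifN; first by apply; rewrite inE kJ orbT.
    by apply: contraNneq pnJ => <-.
  rewrite inE => /orP[/eqP->|kJ]; first by rewrite eqxx.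
  rewrite ifN; first exact: cw.
  by apply: contraNneq pnJ => <-.
have -> : cylinder J i = \big[setU/set0]_(j <- index_enum 'I_M) F j.
  rewrite -bigcup_seq; apply/seteqP; split=> w.
    move=> cw; exists (r p w); first exact: mem_index_enum.
    exact/FE.
  by move=> [j _ /FE[]].
rewrite ge0_integral_bigsetU; first last.
- by move=> w _; rewrite lee_fin.
- apply/measurable_EFinP; apply: measurable_funTS; exact: measurable_iterate.
- by move=> j k _ _ [w [/FE[<- _] /FE[<- _]]].
- exact: index_enum_uniq.
- by move=> j; exact: measurable_cylinder.
rewrite [in RHS]/= mean_iter_sum mulr_suml -sumEFin; apply: eq_bigr => j _.
(* On [F j] the step taken is the fixed map [step j], so the induction hypothesis applies to
   [h \o step j] and the longer list [p :: J]. *)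
transitivity (\int[Pr]_(w in F j) ((h \o step j) (x p w))%:E)%E.
  by apply: eq_integral => w /set_mem /FE[rj _]; rewrite x_S rj.
have pJ' : all (leq p) (p :: J).
  by rewrite /= leqnn; apply: sub_all pJ => k; exact: ltnW.
rewrite IH ?cons_uniq ?pnJ //; last by move=> z; exact: h0.
rewrite big_cons eqxx mulrA (mulrC (mean_iter _ _)); congr (_ * _)%:E.
rewrite big_seq [RHS]big_seq; apply: eq_bigr => k kJ.
by rewrite ifN //; apply: contraNneq pnJ => <-.
Qed.

(** With the empty list of constraints the cylinder is the whole space; the given index fills its
    family of prescribed values. *)
Lemma expectation_iterate p (h : X -> R) : 'I_M -> (forall z, 0 <= h z) ->
  'E_Pr[(fun w => h (x p w))]%E = (mean_iter p h)%:E.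
Proof.
move=> i0 h0; have := @integral_cylinder p h [::] (fun=> i0) h0 isT isT.
have -> : cylinder [::] (fun=> i0) = setT by apply/seteqP; split=> // w _ k.
by rewrite big_nil mulr1 unlock.
Qed.

End Draws.
End RandomIteration.

(** * Mean decrease of the error in one Kaczmarz step *)

Section Kaczmarz.
Context {R : realType} {M N : nat} (A : 'M[R]_(M, N)) (mu : 'I_M -> R).
Hypothesis hmu : is_distribution mu.
Hypothesis hrow : forall i : 'I_M, 0 < mu i -> row i A != 0.

Lemma rowv_eq0 i : (rowv A i == 0) = (row i A == 0).
Proof. by rewrite /rowv trmx_eq0. Qed.

Lemma norm2_rowv_neq0 i : mu i != 0 -> norm2 (rowv A i) != 0.
Proof.
by move=> mi; rewrite norm2_eq0 rowv_eq0 hrow // lt_def mi; case: hmu => ->.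
Qed.

(* Weighting the normalized rows by the square roots of their probabilities
   makes the mean decrease of the squared error in one step equal to
   [norm2 (B *m e) ^+ 2], where [e] is the error. *)
Definition sampling_scaling : 'M[R]_(M, N) :=
  \matrix_(i, j) (Num.sqrt (mu i) / norm2 (rowv A i) * A i j).

Local Notation B := sampling_scaling.

Lemma row_sampling_scaling i :
  row i B = (Num.sqrt (mu i) / norm2 (rowv A i)) *: row i A.
Proof. by apply/rowP => j; rewrite !mxE. Qed.

(** Row [i] of the scaled matrix has squared norm [mu i], also when [mu i] is 0, and these weights
    sum to 1. *)
Lemma frob_norm_sampling_scaling : frob_norm B = 1.
Proof.
have [mu0 mu1] := hmu.
rewrite /frob_norm -[RHS]sqrtr1 -mu1; congr Num.sqrt; apply: eq_bigr => i _.
have -> : \sum_j B i j ^+ 2 =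
    mu i / norm2 (rowv A i) ^+ 2 * norm2 (rowv A i) ^+ 2.
  rewrite {2}sqr_norm2 /dotv mulr_sumr; apply: eq_bigr => j _.
  by rewrite !mxE !exprMn sqr_sqrtr // exprVn -expr2.
have [->|mi] := eqVneq (mu i) 0; first by rewrite !mul0r.
by rewrite divfK // sqrf_eq0 norm2_rowv_neq0.
Qed.

Lemma sqr_norm2_sampling_scaling (e : 'cV[R]_N) :
  norm2 (B *m e) ^+ 2 =
  \sum_i mu i * (dotv (rowv A i) e ^+ 2 / norm2 (rowv A i) ^+ 2).
Proof.
have [mu0 _] := hmu.
rewrite sqr_norm2; apply: eq_bigr => i _; rewrite mulmx_dotv.
have -> : dotv (rowv B i) e =
    Num.sqrt (mu i) / norm2 (rowv A i) * dotv (rowv A i) e.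
  by rewrite /dotv mulr_sumr; apply: eq_bigr => j _; rewrite !mxE mulrA.
by rewrite -expr2 !exprMn sqr_sqrtr // exprVn mulrAC mulrA.
Qed.

Context (b : 'cV[R]_M) (xstar : 'cV[R]_N) (hb : A *m xstar = b).

Lemma kaczmarz_step_dist i x : norm2 (rowv A i) != 0 ->
  norm2 (kaczmarz_step A b i x - xstar) ^+ 2 =
  norm2 (x - xstar) ^+ 2
  - dotv (rowv A i) (x - xstar) ^+ 2 / norm2 (rowv A i) ^+ 2.
Proof.
move=> a0; rewrite /kaczmarz_step -hb mulmx_dotv.
set a := rowv A i; set e := x - xstar.
(* Consistency expresses the residual through the error alone. *)
have -> : dotv a xstar - dotv a x = - dotv a e by rewrite dotvBr opprB.
rewrite mulNr scaleNr addrAC -/e !sqr_norm2 dotv_subZ.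
have : dotv a a != 0 by rewrite -sqr_norm2 sqrf_eq0.
by move=> ?; field.
Qed.

Lemma mean_kaczmarz_step x :
  \sum_i mu i * norm2 (kaczmarz_step A b i x - xstar) ^+ 2 =
  norm2 (x - xstar) ^+ 2 - norm2 (B *m (x - xstar)) ^+ 2.
Proof.
have [_ mu1] := hmu.
rewrite sqr_norm2_sampling_scaling -[X in X - _]mul1r -mu1 mulr_suml -sumrB.
apply: eq_bigr => i _; rewrite -mulrBr.
have [->|mi] := eqVneq (mu i) 0; first by rewrite !mul0r.
by rewrite kaczmarz_step_dist // norm2_rowv_neq0.
Qed.

Lemma distribution_support : exists i, 0 < mu i.
Proof.
have [mu0 mu1] := hmu; apply/existsP; apply: contraT => /existsPn mu_le0.
have := oner_eq0 R; rewrite -mu1 big1 ?eqxx // => i _.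
by apply/eqP; rewrite eq_le mu0 andbT leNgt mu_le0.
Qed.

Lemma sampling_scaling_contraction :
  full_col_rank B ->
  let s := spectral_norm (lpinv B) in
  [/\ 0 < s, 0 <= 1 - s ^- 2
    & forall x,
      \sum_i mu i * norm2 (kaczmarz_step A b i x - xstar) ^+ 2 <=
      (1 - s ^- 2) * norm2 (x - xstar) ^+ 2].
Proof.
move=> rB s; have [i mi] := distribution_support; have [mu0 _] := hmu.
(* A row of positive probability provides a nonzero vector, which rules out [s <= 0] through |v| <=
   s |B v|. *)
pose v := rowv A i.
have v0 : 0 < norm2 v.
  by rewrite lt_def norm2_ge0 norm2_rowv_neq0 // gt_eqF.
have s0 : 0 < s.
  rewrite ltNge; apply/negP => s_le0.
  have := lt_le_trans v0 (norm2_le_lpinv v rB).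
  by rewrite ltNge mulr_le0_ge0 // norm2_ge0.
have contr x : \sum_i mu i * norm2 (kaczmarz_step A b i x - xstar) ^+ 2 <=
    (1 - s ^- 2) * norm2 (x - xstar) ^+ 2.
  rewrite mean_kaczmarz_step mulrBl mul1r lerB // mulrC ler_pdivrMr ?exprn_gt0 //.
  rewrite -exprMn ler_sqr ?nnegrE ?norm2_ge0 //.
    by rewrite mulrC norm2_le_lpinv.
  by rewrite mulr_ge0 ?norm2_ge0 ?ltW.
(* At the point with error [v] the left side is a mean of squares, so the factor multiplying |v|^2 >
   0 cannot be negative. *)
split=> //; have := contr (v + xstar); rewrite addrK.
rewrite -(@pmulr_lge0 _ (norm2 v ^+ 2)) ?exprn_gt0 //; apply: le_trans.
by apply: sumr_ge0 => j _; rewrite mulr_ge0 ?sqr_ge0.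
Qed.

End Kaczmarz.

(** * Mean-square convergence at the rate given by the scaled condition number *)

Theorem proposition6 (R : realType) (M N : nat) (A : 'M[R]_(M, N))
    (mu : 'I_M -> R)
    (hA : full_col_rank A)
    (hmu : is_distribution mu)
    (hrow : forall i : 'I_M, 0 < mu i -> row i A != 0) :
  exists B : 'M[R]_(M, N),
    [/\ row_scaling A B,
        forall i : 'I_M, 0 < mu i -> row i B != 0
      & forall (d : measure_display) (T : measurableType d)
               (Pr : probability T R) (r : nat -> T -> 'I_M),
          iid_draws Pr mu r ->
        forall (b : 'cV[R]_M) (x0 xstar : 'cV[R]_N),
          A *m xstar = b ->
        forall p : nat,
          ('E_Pr [ (fun w => norm2 (kaczmarz A b x0 (fun k => r k w) p - xstar) ^+ 2)%R ]
            <= (1 - (kappa B)^-1 ^+ 2) ^+ p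
               * ((norm2 (x0 - xstar) ^+ 2)%R)%:E)%E].
Proof.
exists (sampling_scaling A mu); split.
- by exists (fun i => Num.sqrt (mu i) / norm2 (rowv A i)) => i;
    exact: row_sampling_scaling.
- move=> i mi; rewrite row_sampling_scaling scaler_eq0 negb_or hrow // andbT.
  rewrite mulf_neq0 ?invr_neq0 //; first by rewrite gt_eqF ?sqrtr_gt0.
  by rewrite (norm2_rowv_neq0 hmu) // gt_eqF.
move=> d T Pr r hr b x0 xstar hb p.
have [mu0 _] := hmu; have [i0 _] := distribution_support hmu.
have h0 z : 0 <= norm2 (z - xstar) ^+ 2 by exact: sqr_ge0.
have -> := expectation_iterate (step := kaczmarz_step A b) (x0 := x0) hr
  (x := fun p w => kaczmarz A b x0 (fun k => r k w) p)
  (fun=> erefl) (fun _ _ => erefl) p i0 h0.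
(* A real factor [q] serves both cases: 1 - s^-2 for finite [kappa], and 1 for infinite [kappa]. *)
have bound q : 0 <= q -> (forall x,
    \sum_i mu i * norm2 (kaczmarz_step A b i x - xstar) ^+ 2 <=
      q * norm2 (x - xstar) ^+ 2) ->
    ((mean_iter mu (kaczmarz_step A b) x0 p
        (fun z => (norm2 (z - xstar) ^+ 2)%R))%:E <=
     q%:E ^+ p * ((norm2 (x0 - xstar) ^+ 2)%R)%:E)%E.
  move=> q0 hq; rewrite -EFin_expe -EFinM lee_fin.
  exact: mean_iter_contract.
rewrite /kappa frob_norm_sampling_scaling // mul1e /lpinv_norm.
case: ifPn => [rB|_].
  have [s0 q0 hq] := sampling_scaling_contraction hmu hrow hb rB.
  rewrite inver gt_eqF //.
  by have := bound _ q0 hq; rewrite -exprVn EFinB EFin_expe.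
(* Since +oo^-1 = 0 the factor is 1, and one step lowers the mean squared error by |B e|^2 >= 0. *)
rewrite invey expe2 mule0 sube0; apply: bound => // x.
by rewrite mean_kaczmarz_step // mul1r gerBl sqr_ge0.
Qed.
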